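(* Let $d\ge 2$. For $d\times d$ complex matrices one has: a) $$C_{1,\infty,\infty}=\begin{cases} d\,|1+e^{i\pi/d}|=d\sqrt{2+2\cos(\pi/d)} & \text{if } d \text{ is odd},\\ 2d & \text{if } d\text{ is even};\end{cases}$$ b) $$C_{\infty,1,1}=\frac{\sqrt{27}}{4}.$$
   Context: For a complex $d\times d$ matrix $X$ with singular values $\sigma_1\ge\dots\ge\sigma_d\ge 0$, the Schatten $p$-norm is $\|X\|_p=(\sigma_1^p+\cdots+\sigma_d^p)^{1/p}$ for $1\le p<\infty$, and $\|X\|_\infty=\sigma_1$. For $p,q,r\in[1,\infty]$, $C_{p,q,r}$ denotes the smallest constant $C$ (for the given $d$) such that $\|XY-YX\|_p\le C\,\|X\|_q\,\|Y\|_r$ for all complex $d\times d$ matrices $X,Y$. *)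

(* Defs.v *)
From HB Require Import structures.
From mathcomp Require Import all_boot all_order all_algebra.
From mathcomp Require Import complex.
From mathcomp Require Import boolp classical_sets reals ereal exp trigo.

Set Implicit Arguments.
Unset Strict Implicit.
Unset Printing Implicit Defensive.

Import Order.TTheory GRing.Theory Num.Theory.

Local Open Scope classical_set_scope.
Local Open Scope ring_scope.
Local Open Scope sesquilinear_scope.

(* The eigenvalues of X^* X are nonnegative reals, but [spectral_diag] lists
   them in R[i]: taking the real part loses nothing. *)
Definition singular_values (R : realType) (d : nat) (X : 'M[R[i]]_d) : seq R :=
  sort >=%R
    [seq Num.sqrt (complex.Re (spectral_diag (X ^t* *m X) 0 j)) | j : 'I_d].

(* Meaningful only for 1 <= p; the value 0 at p = -oo is a dummy. *)
Definition schatten_norm (R : realType) (d : nat) (p : \bar R)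
    (X : 'M[R[i]]_d) : R :=
  match p with
  | r%:E => (\sum_(s <- singular_values X) s `^ r) `^ r^-1
  | +oo%E => head 0 (singular_values X)
  | -oo%E => 0
  end.

Definition commutator_bounds (R : realType) (d : nat) (p q r : \bar R) : set R :=
  [set C | forall X Y : 'M[R[i]]_d,
     schatten_norm p (X *m Y - Y *m X)
       <= C * schatten_norm q X * schatten_norm r Y].

(* C = C_{p,q,r}: the smallest constant, in particular attained. *)
Definition is_commutator_const (R : realType) (d : nat) (p q r : \bar R)
    (C : R) : Prop :=
  commutator_bounds d p q r C /\ lbound (commutator_bounds d p q r) C.

(* e^{it}, by Euler's formula. *)
Definition expi (R : realType) (t : R) : R[i] := Complex (cos t) (sin t).

(* Main.v *)
(* Singular value decompositions reduce both suprema to extreme points.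

   (a) Contractions are means of two unitaries, and for unitary X, Y one has
   |XY - YX|_1 = |S - 1|_1, S being the group commutator, of determinant 1.
   Writing its eigenvalues as -e^(2 i t_j) with |t_j| <= pi/2, the norm is
   2 sum_j cos t_j; for odd d the determinant forces cos (sum_j t_j) = 0, hence
   sum_j |t_j| >= pi/2, and concavity of cos gives the bound 2 d cos (pi/2d).
   Clock and shift matrices attain it.

   (b) For rank one X, Y the coefficients of XY - YX are z1 z2 z3 + w1 w2 w3, where
   z_i = <p_i, q_i> and w_i = - <p_i, q_(i+1)> for six unit vectors.  Adjusting
   phases and using AM-GM, this is at most x^3 + y^3 with x, y the means of the
   real parts of the z_i and of the w_i.  A Gram matrix inequality gives
   x^2 - x y + y^2 <= 3/4, and x^3 + y^3 = (x + y)(x^2 - x y + y^2).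
   Six plane vectors spaced by 30 degrees attain it. *)
Require Import Defs.
From mathcomp Require Import all_boot all_order all_algebra.
From mathcomp Require Import complex.
From mathcomp Require Import boolp classical_sets reals ereal exp trigo.
From mathcomp Require Import all_fingroup topology normedtype derive.
From mathcomp Require Import ring lra.

Set Implicit Arguments.
Unset Strict Implicit.
Unset Printing Implicit Defensive.

Import Order.TTheory GRing.Theory Num.Theory Num.Def.
Import numFieldNormedType.Exports.

Local Open Scope ring_scope.
Local Open Scope sesquilinear_scope.

(** Two block triangular multiples of one block matrix [M] give [det M = det (X - AB)] and
    [X^n det M = X^n det (X - BA)]; then [X^n] is cancelled. *)
Lemma char_poly_mulC (D : idomainType) n (A B : 'M[D]_n) :
  char_poly (A *m B) = char_poly (B *m A).
Proof.
rewrite /char_poly /char_poly_mx !map_mxM /=.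
set A' := map_mx polyC A; set B' := map_mx polyC B.
pose M := block_mx ('X%:M) A' B' (1%:M : 'M_n).
have EM : \det M = \det ('X%:M - A' *m B').
  have : M *m block_mx 1%:M 0 (- B') 1%:M
       = block_mx ('X%:M - A' *m B') A' 0 1%:M.
    by rewrite mulmx_block !(mulmx1, mulmx0, mul1mx, mulmxN, add0r) subrr.
  by move=> /(congr1 determinant); rewrite det_mulmx det_lblock det_ublock
            !det1 !mulr1.
have : block_mx 1%:M 0 (- B') 'X%:M *m M
     = block_mx 'X%:M A' 0 ('X%:M - B' *m A').
  rewrite mulmx_block !(mulmx1, mulmx0, mul1mx, mul0mx, addr0, mulNmx).
  by rewrite -scalar_mxC addNr addrC.
move=> /(congr1 determinant); rewrite det_mulmx det_lblock det_ublock.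
rewrite det1 mul1r EM det_scalar => /mulfI; apply.
by rewrite expf_neq0 // polyX_eq0.
Qed.

(** * Spectral theorem and singular value decomposition *)

Section SVD.
Variable C : numClosedFieldType.

Lemma char_poly_normal n (A : 'M[C]_n) : A \is normalmx ->
  char_poly A = \prod_(i < n) ('X - (spectral_diag A 0 i)%:P).
Proof.
move=> /orthomx_spectralP {1}->.
rewrite -mulmxA char_poly_mulC mulmxK ?spectral_unit //.
rewrite char_poly_trig ?diag_mx_is_trig //.
by apply: eq_bigr => i _; rewrite mxE eqxx mulr1n.
Qed.

Lemma eq_prod_XsubC_perm n (a b : 'I_n -> C) :
    \prod_(i < n) ('X - (a i)%:P) = \prod_(i < n) ('X - (b i)%:P) ->
  exists s : 'S_n, forall i, a i = b (s i).
Proof.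
move=> eab.
have : perm_eq [tuple a i | i < n] [tuple b i | i < n].
  apply: prod_XsubC_eq.
  rewrite !big_tuple; under eq_bigr do rewrite tnth_mktuple.
  by rewrite eab; under [RHS]eq_bigr do rewrite tnth_mktuple.
move=> /tuple_permP[s /= es]; exists s => i.
have := congr1 (nth 0 ^~ i) es.
rewrite (nth_map i) ?size_enum_ord // nth_ord_enum => ->.
by rewrite (nth_map i) ?size_enum_ord // nth_ord_enum tnth_mktuple.
Qed.

Lemma adjmxM m n p (A : 'M[C]_(m, n)) (B : 'M_(n, p)) :
  (A *m B)^t* = B^t* *m A^t*.
Proof. by rewrite trmx_mul map_mxM. Qed.

Lemma adj_diag_mx n (D : 'rV[C]_n) : (diag_mx D)^t* = diag_mx (map_mx conjC D).
Proof. by rewrite tr_diag_mx map_diag_mx. Qed.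

Lemma unitarymxC n (U : 'M[C]_n) : U \is unitarymx -> U^t* *m U = 1%:M.
Proof. by move=> /unitarymxP/mulmx1C. Qed.

Lemma diag_mx_perm n (D E : 'rV[C]_n) (s : 'S_n) :
  (forall i, D 0 i = E 0 (s i)) ->
  diag_mx D = perm_mx s *m diag_mx E *m (perm_mx s)^t*.
Proof.
move=> DE; rewrite tr_perm_mx map_perm_mx -row_permE -col_permE.
by apply/matrixP => i j; rewrite !mxE DE (inj_eq perm_inj).
Qed.

Lemma perm_mx_unitary n (s : 'S_n) : perm_mx s \is @unitarymx C n n.
Proof.
by apply/unitarymxP; rewrite tr_perm_mx map_perm_mx -perm_mxM mulgV perm_mx1.
Qed.

(** Both matrices diagonalize unitarily; the diagonals agree up to a permutation, whose matrix is
    unitary. *)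
Lemma normal_unitary_similar n (A B : 'M[C]_n) :
    A \is normalmx -> B \is normalmx -> char_poly A = char_poly B ->
  exists2 W, W \is unitarymx & A = W^t* *m B *m W.
Proof.
move=> nA nB; rewrite !char_poly_normal // => /eq_prod_XsubC_perm[s] AB.
set P := spectralmx A; set Q := spectralmx B.
have uP : P \is unitarymx by exact: spectral_unitarymx.
have uQ : Q \is unitarymx by exact: spectral_unitarymx.
exists (Q^t* *m (perm_mx s)^t* *m P).
  by rewrite !mul_unitarymx ?trmxC_unitary ?perm_mx_unitary.
have /orthomx_spectralP{1}-> := nA; have /orthomx_spectralP{1}-> := nB.
rewrite -/P -/Q !invmx_unitary // (diag_mx_perm AB) !adjmxM !trmxCK !mulmxA.
by rewrite !(mulmxtVK _ uQ).
Qed.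

Lemma polar_factor (z : C) : exists2 u, `|u| = 1 & z = u * `|z|.
Proof.
have [->|z0] := eqVneq z 0; first by exists 1; rewrite ?normr1 // normr0 mulr0.
exists (z / `|z|); last by rewrite divfK // normr_eq0.
by rewrite normrM normfV normr_id divff // normr_eq0.
Qed.

Lemma diag_unitary n (D : 'rV[C]_n) :
  (forall i, `|D 0 i| = 1) -> diag_mx D \is unitarymx.
Proof.
move=> D1; apply/unitarymxP; rewrite adj_diag_mx mulmx_diag -diag_const_mx.
by congr diag_mx; apply/rowP => i; rewrite !mxE -normCK D1 expr1n.
Qed.

(* [A A^*] and [A^* A] have the same characteristic polynomial, so they are
   conjugate by a unitary [W]; then [W A] is normal and can be diagonalized. *)
Lemma svd n (A : 'M[C]_n) : exists U V (s : 'I_n -> C),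
  [/\ U \is unitarymx, V \is unitarymx,
      A = U *m diag_mx (\row_i s i) *m V, forall i, 0 <= s i &
      exists p : 'S_n, forall i,
        s i ^+ 2 = spectral_diag (A^t* *m A) 0 (p i)].
Proof.
have nAA : A^t* *m A \is normalmx by apply/normalmxP; rewrite adjmxM trmxCK.
have nAA' : A *m A^t* \is normalmx by apply/normalmxP; rewrite adjmxM trmxCK.
have [W uW AA] := normal_unitary_similar nAA' nAA (char_poly_mulC _ _).
have nN : W *m A \is normalmx.
  apply/normalmxP; rewrite adjmxM !mulmxA -(mulmxA W) AA !mulmxA.
  by rewrite (unitarymxP uW) mul1mx (mulmxtVK _ uW) mulmxKtV.
set P := spectralmx (W *m A); set D := spectral_diag (W *m A).
have uP : P \is unitarymx by exact: spectral_unitarymx.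
have eN : W *m A = P^t* *m diag_mx D *m P.
  by have /orthomx_spectralP{1}-> := nN; rewrite invmx_unitary.
have /fin_all_exists2[u u1 Du] := fun i => polar_factor (D 0 i).
(* The phases of the eigenvalues of [W A] go into the left unitary factor; the moduli are the
   singular values. *)
exists (W^t* *m P^t* *m diag_mx (\row_i u i)), P, (fun i => `|D 0 i|).
split=> //.
- rewrite !mul_unitarymx ?trmxC_unitary // diag_unitary // => i.
  by rewrite mxE.
- transitivity (W^t* *m (W *m A)).
    by rewrite mulmxA unitarymxC ?mul1mx.
  rewrite eN !mulmxA -(mulmxA _ (diag_mx _) (diag_mx _)) mulmx_diag.
  congr (_ *m diag_mx _ *m _).
  by apply/rowP => i; rewrite !mxE -Du.
(* The basis [P] also diagonalizes [A^* A], with diagonal [|D_i|^2]; comparing characteristic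
   polynomials yields the permutation. *)
have eAA : A^t* *m A = P^t* *m (diag_mx (\row_i (`|D 0 i| ^+ 2)) *m P).
  have -> : A^t* *m A = (W *m A)^t* *m (W *m A).
    by rewrite adjmxM !mulmxA mulmxKtV.
  rewrite eN !adjmxM trmxCK adj_diag_mx !mulmxA (mulmxtVK _ uP).
  rewrite -(mulmxA _ (diag_mx _) (diag_mx _)) mulmx_diag.
  congr (_ *m diag_mx _ *m _).
  by apply/rowP => i; rewrite !mxE normCKC.
apply: eq_prod_XsubC_perm; rewrite -char_poly_normal //.
rewrite eAA char_poly_mulC mulmxtVK // char_poly_trig ?diag_mx_is_trig //.
by apply: eq_bigr => i _; rewrite !mxE eqxx mulr1n.
Qed.
End SVD.

(** * Unit rows, and variational bounds from singular values *)

Section UnitRows.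
Variables (C : numClosedFieldType) (n : nat).

Lemma unit_row_sum (u : 'rV[C]_n) : u \is unitarymx ->
  \sum_j `|u 0 j| ^+ 2 = 1.
Proof.
move=> /unitarymxP/matrixP/(_ 0 0); rewrite !mxE eqxx mulr1n => <-.
by apply: eq_bigr => j _; rewrite !mxE normCK.
Qed.

Lemma row_unitary (U : 'M[C]_n) i : U \is unitarymx -> row i U \is unitarymx.
Proof.
move=> uU; rewrite rowE mul_unitarymx //; apply/unitarymxP/matrixP => j k.
rewrite !ord1 !mxE (bigD1 i) //= big1 => [|l li]; rewrite !mxE ?eqxx.
  by rewrite addr0 conjC1 mulr1.
by rewrite (negPf li) mul0r.
Qed.

Lemma scale_unitary z (v : 'rV[C]_n) :
  `|z| = 1 -> v \is unitarymx -> z *: v \is unitarymx.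
Proof.
move=> z1 /unitarymxP v1; apply/unitarymxP.
rewrite linearZ /= map_mxZ -scalemxAl -scalemxAr scalerA v1 -normCK z1.
by rewrite expr1n scale1r.
Qed.

Lemma pairingZ a b (u v : 'rV[C]_n) :
  ((a *: u) *m (conjC b *: v)^t*) 0 0 = a * b * (u *m v^t*) 0 0.
Proof.
by rewrite linearZ /= map_mxZ -scalemxAl -scalemxAr scalerA mxE /= conjCK.
Qed.

(** Termwise [|u_j| |v_j| <= (|u_j|^2 + |v_j|^2) / 2], and the right sides add up to 1. *)
Lemma diag_form_le (u v : 'rV[C]_n) (s : 'I_n -> C) M :
    u \is unitarymx -> v \is unitarymx -> (forall i, 0 <= s i <= M) ->
  `|(u *m diag_mx (\row_i s i) *m v^t*) 0 0| <= M.
Proof.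
move=> /unit_row_sum u1 /unit_row_sum v1 sM.
have -> : M = \sum_j M * ((`|u 0 j| ^+ 2 + `|v 0 j| ^+ 2) / 2).
  by rewrite -mulr_sumr -mulr_suml big_split /= u1 v1 divff ?mulr1 ?pnatr_eq0.
rewrite mxE; apply: le_trans (ler_norm_sum _ _ _) _.
apply: ler_sum => j _; have /andP[s0 sj] := sM j.
rewrite mul_mx_diag !mxE !normrM norm_conjC (ger0_norm s0) mulrAC mulrC.
apply: ler_pM => //.
rewrite ler_pdivlMr ?ltr0n // -subr_ge0.
have -> : `|u 0 j| ^+ 2 + `|v 0 j| ^+ 2 - `|u 0 j| * `|v 0 j| * 2
        = (`|u 0 j| - `|v 0 j|) ^+ 2 by ring.
by rewrite real_exprn_even_ge0 // rpredB ?normr_real.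
Qed.

Lemma unit_pairing_le (u v : 'rV[C]_n) :
  u \is unitarymx -> v \is unitarymx -> `|(u *m v^t*) 0 0| <= 1.
Proof.
move=> uu uv; have := @diag_form_le u v (fun=> 1) 1 uu uv.
have -> : \row_(i < n) 1 = const_mx 1 :> 'rV[C]_n.
  by apply/rowP => i; rewrite !mxE.
by rewrite diag_const_mx mulmx1; apply => i; rewrite ler01 lexx.
Qed.

Lemma unitary_entry_le (U : 'M[C]_n) i j : U \is unitarymx -> `|U i j| <= 1.
Proof.
move=> uU; have u1 : row j 1%:M \is @unitarymx C 1 n.
  by apply: row_unitary; apply/unitarymxP; rewrite trmx1 map_mx1 mulmx1.
have := unit_pairing_le (row_unitary i uU) u1.
rewrite mxE (bigD1 j) //= big1 => [|l lj]; rewrite !mxE.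
  by rewrite eqxx conjC1 mulr1 addr0.
by rewrite eq_sym (negPf lj) conjC0 mulr0.
Qed.

Lemma mxtrace_diag_le (Q : 'M[C]_n) (s : 'I_n -> C) :
  Q \is unitarymx -> `|\tr (Q *m diag_mx (\row_i s i))| <= \sum_i `|s i|.
Proof.
move=> uQ; apply: le_trans (ler_norm_sum _ _ _) _; apply: ler_sum => i _.
rewrite mul_mx_diag !mxE normrM -[leRHS]mul1r ler_wpM2r //.
exact: unitary_entry_le.
Qed.

Lemma mxtrace_mulmx3C (W U D V : 'M[C]_n) :
  \tr (W *m (U *m D *m V)) = \tr (V *m W *m U *m D).
Proof. by rewrite mulmxA mxtrace_mulC !mulmxA. Qed.

Lemma unitary_form_le (u v : 'rV[C]_n) (U : 'M[C]_n) :
    u \is unitarymx -> U \is unitarymx -> v \is unitarymx ->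
  `|(u *m U *m v^t*) 0 0| <= 1.
Proof. by move=> hu hU hv; rewrite unit_pairing_le ?mul_unitarymx. Qed.

(** With [mxtrace_svd_attained], this presents the trace norm as a maximum over unitary [W]. *)
Lemma mxtrace_svd_le (W U V : 'M[C]_n) (s : 'I_n -> C) :
    W \is unitarymx -> U \is unitarymx -> V \is unitarymx ->
  `|\tr (W *m (U *m diag_mx (\row_i s i) *m V))| <= \sum_i `|s i|.
Proof.
move=> hW hU hV; rewrite mxtrace_mulmx3C; apply: mxtrace_diag_le.
by rewrite !mul_unitarymx.
Qed.

Lemma mxtrace_svd_attained (U V : 'M[C]_n) (s : 'I_n -> C) :
    U \is unitarymx -> V \is unitarymx -> exists2 W, W \is unitarymx &
  \tr (W *m (U *m diag_mx (\row_i s i) *m V)) = \sum_i s i.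
Proof.
move=> hU hV; exists (V^t* *m U^t*).
  by rewrite mul_unitarymx ?trmxC_unitary.
rewrite mxtrace_mulmx3C !mulmxA (unitarymxP hV) mul1mx unitarymxC // mul1mx.
by rewrite mxtrace_diag; apply: eq_bigr => i _; rewrite mxE.
Qed.

(** With [svd_form_attained], this presents the operator norm as a maximum over pairs of unit
    rows. *)
Lemma svd_form_le (u v : 'rV[C]_n) (U V : 'M[C]_n) (s : 'I_n -> C) M :
    u \is unitarymx -> v \is unitarymx ->
    U \is unitarymx -> V \is unitarymx -> (forall i, 0 <= s i <= M) ->
  `|(u *m (U *m diag_mx (\row_i s i) *m V) *m v^t*) 0 0| <= M.
Proof.
move=> hu hv hU hV sM; rewrite !mulmxA -mulmxA.
have -> : V *m v^t* = (v *m V^t*)^t* by rewrite adjmxM trmxCK.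
by apply: diag_form_le; rewrite ?mul_unitarymx ?trmxC_unitary.
Qed.

Lemma svd_form_attained (U V : 'M[C]_n) (s : 'I_n -> C) i :
    U \is unitarymx -> V \is unitarymx -> exists u v : 'rV[C]_n,
  [/\ u \is unitarymx, v \is unitarymx &
      (u *m (U *m diag_mx (\row_i s i) *m V) *m v^t*) 0 0 = s i].
Proof.
move=> hU hV; exists (row i (U^t*)), (row i V).
rewrite !row_unitary ?trmxC_unitary //; split=> //.
rewrite !rowE adjmxM !mulmxA -(mulmxA _ (U^t*)) unitarymxC // mulmx1.
rewrite (mulmxtVK _ hV) -rowE trmx_delta map_delta_mx.
by rewrite -colE !mxE eqxx mulr1n.
Qed.

Lemma svd_sum_rank1 (U V : 'M[C]_n) (s : 'I_n -> C) :
  U^t* *m diag_mx (\row_i s i) *m V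
  = \sum_i s i *: ((row i U)^t* *m row i V).
Proof.
apply/matrixP => i j; rewrite mul_mx_diag !mxE summxE.
by apply: eq_bigr => k _; rewrite !mxE big_ord1 !mxE mulrCA mulrA.
Qed.

End UnitRows.

(** * Schatten 1- and infinity-norms by duality *)

Section SchattenNorm.
Variables (R : realType) (d : nat).
Implicit Types (X Y A W : 'M[R[i]]_d) (u v : 'rV[R[i]]_d).
Local Open Scope complex_scope.

(** Agreement up to order suffices, since sums and maxima are all that is taken of the singular
    values. *)
Lemma svd_singular_values X : exists U V (s : 'I_d -> R),
  [/\ U \is unitarymx, V \is unitarymx,
      X = U *m diag_mx (\row_i (s i)%:C) *m V, forall i, 0 <= s i &
      perm_eq [seq s i | i : 'I_d] (singular_values X)].
Proof.
have [U [V [s [uU uV eX s0 [p sp]]]]] := svd X.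
have sR i : (complex.Re (s i))%:C = s i by rewrite RRe_real // ger0_real.
have s0R i : 0 <= complex.Re (s i) by rewrite -ler0c sR.
have sE : \row_i s i = \row_i (complex.Re (s i))%:C.
  by apply/rowP => i; rewrite !mxE sR.
rewrite sE in eX; exists U, V, (fun i => complex.Re (s i)).
split; [exact: uU | exact: uV | exact: eX | exact: s0R |].
rewrite perm_sym perm_sort perm_sym.
have -> : [seq complex.Re (s i) | i : 'I_d]
  = [seq Num.sqrt (complex.Re (spectral_diag (X^t* *m X) 0 j))
     | j <- [seq p i | i : 'I_d]].
  rewrite -map_comp; apply: eq_map => i /=.
  by rewrite -sp -sR -rmorphXn /= sqrtr_sqr ger0_norm.
apply: perm_map; apply: uniq_perm; rewrite ?enum_uniq //.
  by rewrite map_inj_uniq ?enum_uniq //; exact: perm_inj.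
move=> j; rewrite mem_enum inE; apply/mapP.
by exists (p^-1%g j); rewrite ?mem_enum ?permKV.
Qed.

Lemma schatten_norm1E X (s : 'I_d -> R) : (forall i, 0 <= s i) ->
    perm_eq [seq s i | i : 'I_d] (singular_values X) ->
  schatten_norm 1%:E X = \sum_i s i.
Proof.
move=> s0 ps; rewrite /schatten_norm -(perm_big _ ps) /= big_map big_enum /=.
under eq_bigr do rewrite powRr1 //.
by rewrite invr1 powRr1 // sumr_ge0.
Qed.

Lemma schatten_normy_ge X (s : 'I_d -> R) i :
    perm_eq [seq s i | i : 'I_d] (singular_values X) ->
  s i <= schatten_norm +oo%E X.
Proof.
move=> ps; rewrite /schatten_norm.
have : s i \in singular_values X.
  by rewrite -(perm_mem ps); apply: map_f; rewrite mem_enum.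
have : sorted >=%R (singular_values X).
  by apply: sort_sorted => x y; exact: ge_total.
case: (singular_values X) => //= x t st; rewrite inE => /predU1P[->//|].
have /allP := order_path_min ge_trans st.
by move=> /[apply].
Qed.

Lemma schatten_normy_attained X (s : 'I_d -> R) : (0 < d)%N ->
    perm_eq [seq s i | i : 'I_d] (singular_values X) ->
  exists i, schatten_norm +oo%E X = s i.
Proof.
move=> d0 ps; have := perm_mem ps; have := perm_size ps.
rewrite size_map size_enum_ord /schatten_norm.
case: (singular_values X) => [d1|x t _ /(_ x)]; first by rewrite d1 in d0.
by rewrite mem_head => /mapP[i _ ->]; exists i.
Qed.

Lemma schatten_normy_ge0 X : (0 < d)%N -> 0 <= schatten_norm +oo%E X.
Proof.
move=> d0; have [U [V [s [_ _ _ s0 ps]]]] := svd_singular_values X.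
exact: le_trans (s0 (Ordinal d0)) (schatten_normy_ge _ ps).
Qed.

Lemma schatten_norm1_ge0 X : 0 <= schatten_norm 1%:E X.
Proof. by rewrite /schatten_norm powR_ge0. Qed.

Lemma mxtrace_le_schatten_norm1 W X : W \is unitarymx ->
  `|\tr (W *m X)| <= (schatten_norm 1%:E X)%:C.
Proof.
move=> uW; have [U [V [s [uU uV eX s0 ps]]]] := svd_singular_values X.
rewrite (schatten_norm1E s0 ps) rmorph_sum /= {1}eX.
apply: le_trans (mxtrace_svd_le _ uW uU uV) _.
by apply: ler_sum => i _; rewrite ger0_norm ?ler0c.
Qed.

Lemma schatten_norm1_attained X :
  exists2 W, W \is unitarymx & \tr (W *m X) = (schatten_norm 1%:E X)%:C.
Proof.
have [U [V [s [uU uV eX s0 ps]]]] := svd_singular_values X.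
have [W uW E] := mxtrace_svd_attained (fun i => (s i)%:C) uU uV.
exists W; first exact: uW.
by rewrite (schatten_norm1E s0 ps) {1}eX E rmorph_sum.
Qed.

Lemma form_le_schatten_normy u v X : u \is unitarymx -> v \is unitarymx ->
  `|(u *m X *m v^t*) 0 0| <= (schatten_norm +oo%E X)%:C.
Proof.
move=> uu uv; have [U [V [s [uU uV eX s0 ps]]]] := svd_singular_values X.
rewrite {1}eX; apply: (svd_form_le uu uv uU uV) => i.
by rewrite ler0c s0 lecR (schatten_normy_ge _ ps).
Qed.

Lemma schatten_normy_form X : (0 < d)%N -> exists u v,
  [/\ u \is unitarymx, v \is unitarymx &
      (u *m X *m v^t*) 0 0 = (schatten_norm +oo%E X)%:C].
Proof.
move=> d0; have [U [V [s [uU uV eX s0 ps]]]] := svd_singular_values X.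
have [i ->] := schatten_normy_attained d0 ps.
rewrite {1}eX; exact: svd_form_attained (fun i => (s i)%:C) i uU uV.
Qed.

Lemma sum_rank1_unit X : exists (U V : 'M[R[i]]_d) (s : 'I_d -> R),
  [/\ U \is unitarymx, V \is unitarymx, forall i, 0 <= s i,
      \sum_i s i = schatten_norm 1%:E X &
      X = \sum_i (s i)%:C *: ((row i U)^t* *m row i V)].
Proof.
have [U [V [s [uU uV eX s0 ps]]]] := svd_singular_values X.
have uU' : U^t* \is unitarymx by rewrite trmxC_unitary.
exists (U^t*), V, s; split; [exact: uU' | exact: uV | exact: s0 | |].
  by rewrite (schatten_norm1E s0 ps).
by have := svd_sum_rank1 (U^t*) V (fun i => (s i)%:C); rewrite trmxCK -eX.
Qed.

(* A number in [0,1] is the mean of a unimodular number and its conjugate. *)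
Lemma mean_unitary X : (0 < d)%N -> exists U V,
  [/\ U \is unitarymx, V \is unitarymx &
      X = (schatten_norm +oo%E X / 2)%:C *: (U + V)].
Proof.
move=> d0; have [U [V [s [uU uV eX s0 ps]]]] := svd_singular_values X.
(* If [M = 0], division by zero makes every [c i] equal to 0, and [s i = M * c i] still holds
   because all [s i] vanish. *)
set M := schatten_norm +oo%E X; pose c i := s i / M.
have M0 : 0 <= M by exact: schatten_normy_ge0.
have sM i : s i = M * c i.
  have := schatten_normy_ge i ps; rewrite -/M /c.
  have [-> si|Mn0 _] := eqVneq M 0; last by rewrite mulrCA divff // mulr1.
  by rewrite mul0r; apply/eqP; rewrite eq_le si s0.
have c01 i : 0 <= c i <= 1.
  rewrite divr_ge0 //=; have [M1|Mn0] := eqVneq M 0.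
    by rewrite /c M1 invr0 mulr0 ler01.
  by rewrite ler_pdivrMr ?mul1r ?lt_def ?Mn0 //; exact: schatten_normy_ge.
pose r i := Num.sqrt (1 - c i ^+ 2).
have r1 i : r i ^+ 2 = 1 - c i ^+ 2.
  rewrite sqr_sqrtr // subr_ge0 expr_le1 //; by have /andP[] := c01 i.
have hD0 : diag_mx (\row_i (c i +i* r i)) \is unitarymx.
  by apply: diag_unitary => i; rewrite mxE normc_def /= r1 addrC subrK sqrtr1.
have hD1 : diag_mx (\row_i (c i -i* r i)) \is unitarymx.
  apply: diag_unitary => i.
  by rewrite mxE normc_def /= sqrrN r1 addrC subrK sqrtr1.
exists (U *m diag_mx (\row_i (c i +i* r i)) *m V),
       (U *m diag_mx (\row_i (c i -i* r i)) *m V).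
split.
- exact: mul_unitarymx (mul_unitarymx uU hD0) uV.
- exact: mul_unitarymx (mul_unitarymx uU hD1) uV.
rewrite {1}eX -mulmxDl -mulmxDr -linearD /= scalemxAl scalemxAr.
rewrite -linearZ /=; congr (_ *m diag_mx _ *m _); apply/rowP => i.
rewrite !mxE sM; apply/eqP; rewrite eq_complex /=.
by apply/andP; split; apply/eqP; field.
Qed.

(** Turns a test pair into a lower bound: [x] and [y] are the norms of the test matrices, and
    [0 < k] forces [K] to be positive. *)
Lemma bound_ge_constant (k n K x y : R) : 0 < k -> k <= n -> n <= K * x * y ->
  0 <= x <= 1 -> 0 <= y <= 1 -> k <= K.
Proof.
rewrite -mulrA => k0 kn nK /andP[x0 x1] /andP[y0 y1].
have xy0 : 0 <= x * y by rewrite mulr_ge0.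
have xy1 : x * y <= 1 by rewrite mulr_ile1.
move: (x * y) xy0 xy1 nK => t t0 t1 nK.
by have [K0|K0] := leP 0 K; nra.
Qed.

End SchattenNorm.

(** * The inequality for six unit vectors *)

Section Hexagon.
Variable R : realType.
Local Open Scope complex_scope.

Lemma ReD (a b : R[i]) : complex.Re (a + b) = complex.Re a + complex.Re b.
Proof. by case: a; case: b. Qed.

(** The three cube roots sum to 0, so their real parts cannot all be negative. *)
Lemma cube_root_Re_ge0 (z : R[i]) : `|z| = 1 ->
  exists e, [/\ e ^+ 3 = z, `|e| = 1 & 0 <= complex.Re e].
Proof.
move=> z1; have [r r3] : exists r : R[i], r ^+ 3 = z.
  by exists (3.-root z); rewrite rootCK.
have norm1 (e : R[i]) : e ^+ 3 = z -> `|e| = 1.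
  by move=> e3; apply/eqP; rewrite -(@pexpr_eq1 _ _ 3) // -normrX e3 z1 eqxx.
have [j jS] : exists j : R[i], 1 + j + j ^+ 2 = 0.
  exists ((- 2^-1) +i* (Num.sqrt 3 / 2)).
  have s3 : Num.sqrt 3 ^+ 2 = 3 :> R by rewrite sqr_sqrtr // ler0n.
  apply/eqP; rewrite eq_complex /=; apply/andP; split; apply/eqP; last by field.
  transitivity ((3 - Num.sqrt 3 ^+ 2) / 4 : R); first by field.
  by rewrite s3 subrr mul0r.
have j3 : j ^+ 3 = 1.
  apply/eqP; rewrite -subr_eq0.
  have -> : j ^+ 3 - 1 = (j - 1) * (1 + j + j ^+ 2) by ring.
  by rewrite jS mulr0.
have [r0|rN] := lerP 0 (complex.Re r); first by exists r; rewrite (norm1 _ r3).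
have e3 : (r * j) ^+ 3 = z by rewrite exprMn j3 mulr1.
have [rj0|rjN] := lerP 0 (complex.Re (r * j)).
  by exists (r * j); rewrite (norm1 _ e3).
have f3 : (r * j ^+ 2) ^+ 3 = z by rewrite exprMn exprAC j3 expr1n mulr1.
exists (r * j ^+ 2); rewrite (norm1 _ f3); split=> //.
have : complex.Re (r * (1 + j + j ^+ 2)) = 0 by rewrite jS mulr0.
rewrite !mulrDr mulr1 !ReD.
by move=> S0; lra.
Qed.

Lemma mean3_le1 (a b c : R) :
  a <= 1 -> b <= 1 -> c <= 1 -> (a + b + c) / 3 <= 1.
Proof. by move=> *; lra. Qed.

Lemma AGM3 (a b c : R) : 0 <= a -> 0 <= b -> 0 <= c ->
  a * b * c <= ((a + b + c) / 3) ^+ 3.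
Proof.
move=> a0 b0 c0; rewrite -subr_ge0.
have -> : ((a + b + c) / 3) ^+ 3 - a * b * c =
  ((a + b + c) * ((a - b) ^+ 2 + (b - c) ^+ 2 + (c - a) ^+ 2) / 2
   + 3 * (a * (b - c) ^+ 2 + b * (c - a) ^+ 2 + c * (a - b) ^+ 2)) / 27.
  by field.
by do ![exact: sqr_ge0 | apply: addr_ge0 | apply: mulr_ge0 | by []].
Qed.

(* Writing [k z1 z2 z3 = e^3 |z1 z2 z3|] with [c = Re e] in [0,1], the real part
   carries the factor [Re (e^3) = 4c^3 - 3c <= c^3]. *)
Lemma Re_prod3_le (k z1 z2 z3 : R[i]) : `|k| = 1 -> exists e1 e2 e3 : R[i],
  [/\ `|e1| = 1, `|e2| = 1, `|e3| = 1, e1 * e2 * e3 = k &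
      complex.Re (k * (z1 * z2 * z3)) <=
        ((complex.Re (e1 * z1) + complex.Re (e2 * z2) + complex.Re (e3 * z3))
           / 3) ^+ 3].
Proof.
move=> k1; have [u1 n1 E1] := polar_factor z1.
have [u2 n2 E2] := polar_factor z2; have [u3 n3 E3] := polar_factor z3.
have nz u : `|u : R[i]| = 1 -> u != 0.
  by move=> nu; rewrite -normr_eq0 nu oner_eq0.
have [|e [e3 ne e0]] := @cube_root_Re_ge0 (k * (u1 * u2 * u3)).
  by rewrite !normrM k1 n1 n2 n3 !mulr1.
(* These phases align all three numbers with [e], as [(e / u_i) z_i = e |z_i|], and their product is
   [e^3 / (u1 u2 u3) = k]. *)
exists (e / u1), (e / u2), (e / u3).
rewrite !normf_div ne n1 n2 n3 !divr1; split=> //.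
  transitivity (e ^+ 3 / (u1 * u2 * u3)); first by field; rewrite !nz.
  by rewrite e3 mulfK // !mulf_neq0 ?nz.
have -> : k * (z1 * z2 * z3) = e ^+ 3 * (`|z1| * `|z2| * `|z3|).
  by rewrite e3 {1}E1 {1}E2 {1}E3; ring.
have De u z : `|u : R[i]| = 1 -> z = u * `|z : R[i]| -> e / u * z = e * `|z|.
  by move=> nu {1}->; rewrite mulrA divfK ?nz.
rewrite (De _ _ n1 E1) (De _ _ n2 E2) (De _ _ n3 E3) !normc_def.
set a1 := Num.sqrt _; set a2 := Num.sqrt _; set a3 := Num.sqrt _.
have : 0 <= a3 by exact: sqrtr_ge0.
have : 0 <= a2 by exact: sqrtr_ge0.
have : 0 <= a1 by exact: sqrtr_ge0.
move: a1 a2 a3 => a1 a2 a3 a10 a20 a30.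
have := add_Re2_Im2 e; rewrite ne expr1n => /complexI.
case: e e0 {e3 ne De} => c s /= c0 cs.
set lhs := (X in X <= _); set rhs := (X in _ <= X).
have -> : lhs = (c ^+ 3 - 3 * c * s ^+ 2) * (a1 * a2 * a3).
  by rewrite /lhs; ring.
have -> : rhs = c ^+ 3 * ((a1 + a2 + a3) / 3) ^+ 3 by rewrite /rhs; field.
apply: (@le_trans _ _ (c ^+ 3 * (a1 * a2 * a3))).
  rewrite ler_wpM2r ?mulr_ge0 // lerBlDr lerDl.
  by apply: mulr_ge0; [exact: mulr_ge0 | exact: sqr_ge0].
by rewrite ler_wpM2l ?exprn_ge0 // AGM3.
Qed.

(** With [q] the quadratic form, [(x + y)^2 <= 4 q <= 3] where the bound on [q] is available.
    Elsewhere, if [x + y > 0], one variable is less than half the other, so the cubes add up to at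
    most [1/8 + 1 = 9/8]. *)
Lemma quad_form_cubes_le (x y : R) : x <= 1 -> y <= 1 ->
    (0 <= (2 * x - y) * (2 * y - x) -> x ^+ 2 - x * y + y ^+ 2 <= 3 / 4) ->
  x ^+ 3 + y ^+ 3 <= Num.sqrt 27 / 4.
Proof.
move=> x1 y1 Q.
have s0 : 0 <= Num.sqrt 27 :> R by exact: sqrtr_ge0.
have s2 : Num.sqrt 27 ^+ 2 = 27 :> R by rewrite sqr_sqrtr // ler0n.
(* A rational bound that is enough to place [9/8] below [sqrt 27 / 4]. *)
have s5 : 5 <= Num.sqrt 27 :> R by nra.
have -> : x ^+ 3 + y ^+ 3 = (x + y) * (x ^+ 2 - x * y + y ^+ 2) by ring.
have Q0 : 0 <= x ^+ 2 - x * y + y ^+ 2 by nra.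
have [xy0|xy0] := leP (x + y) 0; first by nra.
have [/Q {}Q|N] := lerP 0 ((2 * x - y) * (2 * y - x)).
  rewrite -(@ler_pXn2r _ 2) ?nnegrE ?(mulr_ge0 (ltW xy0) Q0) ?divr_ge0 //.
  set q := x ^+ 2 - x * y + y ^+ 2 in Q Q0 *.
  have sq : (x + y) ^+ 2 <= 4 * q.
    rewrite -subr_ge0.
    have -> : 4 * q - (x + y) ^+ 2 = 3 * (x - y) ^+ 2 by rewrite /q; ring.
    by rewrite mulr_ge0 ?sqr_ge0.
  have q2 : q ^+ 2 <= 9 / 16 by nra.
  have : (x + y) ^+ 2 * q ^+ 2 <= 3 * (9 / 16).
    by apply: ler_pM; rewrite ?sqr_ge0 //; nra.
  by rewrite exprMn exprMn s2; nra.
apply: (@le_trans _ _ (9 / 8)); last by lra.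
have cube_half (a b : R) : 2 * a < b -> b <= 1 -> 0 < a + b ->
    (a + b) * (a ^+ 2 - a * b + b ^+ 2) <= 9 / 8.
  move=> ab b1 ab0; have a2 : a <= 1 / 2 by lra.
  have b0 : 0 <= b by lra.
  have b3 : b ^+ 3 <= 1 by rewrite exprn_ile1.
  (* Since [a] may be negative, the cubes are compared through a factorization. *)
  have a3 : a ^+ 3 <= 1 / 8.
    have -> : 1 / 8 = (1 / 2) ^+ 3 :> R by field.
    rewrite -subr_ge0.
    have -> : (1 / 2) ^+ 3 - a ^+ 3
      = (1 / 2 - a) * ((a + 1 / 4) ^+ 2 + 3 / 16) by field.
    by rewrite mulr_ge0 ?subr_ge0 // addr_ge0 ?sqr_ge0.
  have -> : (a + b) * (a ^+ 2 - a * b + b ^+ 2) = a ^+ 3 + b ^+ 3 by ring.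
  by apply: le_trans (lerD a3 b3) _; lra.
have [xy|yx] := ltP (2 * x) y; first exact: cube_half.
have yx' : 2 * y < x by nra.
have := cube_half y x yx' x1; rewrite addrC => /(_ xy0).
by have -> : x ^+ 2 - x * y + y ^+ 2 = y ^+ 2 - y * x + x ^+ 2 by ring.
Qed.

Variable n : nat.
Implicit Types p q u v : 'rV[R[i]]_n.

(** The real inner product underlying the Hermitian one: once phases are adjusted, only real parts
    matter. *)
Definition rdot u v : R := complex.Re ((u *m v^t*) 0 0).

Lemma rdotC u v : rdot u v = rdot v u.
Proof.
rewrite /rdot -[u *m v^t*]trmxCK adjmxM trmxCK !mxE.
by case: (\sum_j _).
Qed.

Lemma rdot_ge0 u : 0 <= rdot u u.
Proof.
rewrite /rdot mxE -ler0c RRe_real; last first.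
  by rewrite ger0_real // sumr_ge0 // => j _; rewrite !mxE -normCK exprn_ge0.
by rewrite sumr_ge0 // => j _; rewrite !mxE -normCK exprn_ge0.
Qed.

Lemma rdot_unit u : u \is unitarymx -> rdot u u = 1.
Proof. by move=> /unitarymxP; rewrite /rdot => ->; rewrite mxE. Qed.

Lemma rdotDl u v w : rdot (u + v) w = rdot u w + rdot v w.
Proof. by rewrite /rdot mulmxDl mxE ReD. Qed.

Lemma rdotZl (a : R) u v : rdot (a%:C *: u) v = a * rdot u v.
Proof.
rewrite /rdot -scalemxAl mxE; case: ((u *m v^t*) 0 0) => x y /=.
by rewrite mul0r subr0.
Qed.

(** The right side is the square norm of [m p + k p' + t q]. *)
Lemma rdot_comb_ge0 p p' q (m k t : R) :
    p \is unitarymx -> p' \is unitarymx -> q \is unitarymx ->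
  0 <= m ^+ 2 + k ^+ 2 + t ^+ 2 + 2 * (m * k * rdot p p')
         + 2 * (m * t * rdot p q) + 2 * (k * t * rdot p' q).
Proof.
move=> up up' uq; have := rdot_ge0 (m%:C *: p + k%:C *: p' + t%:C *: q).
rewrite !rdotDl !rdotZl !(rdotC _ (_ + _)) !rdotDl !rdotZl !rdot_unit //.
rewrite (rdotC p' p) (rdotC q p) (rdotC q p').
set e1 := (X in 0 <= X -> _); set e2 := (X in _ -> 0 <= X).
by have -> : e1 = e2 by rewrite /e1 /e2; ring.
Qed.

(* With [m = 2x - y], [k = x - 2y] and [Q = x^2 - xy + y^2], the vectors
   [m p_i + k p_(i-1) - 2Q q_i] have total square norm at most [3 Q (3 - 4 Q)]
   as soon as [m k <= 0]; here [g], [z], [w] are the inner products involved. *)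
Lemma hexagon_gram_ineq (g1 g2 g3 z1 z2 z3 w1 w2 w3 : R) :
    let ineq g z w := forall m k t, 0 <= m ^+ 2 + k ^+ 2 + t ^+ 2
      + 2 * (m * k * g) + 2 * (m * t * z) + 2 * (k * t * w) in
    ineq g1 z1 w3 -> ineq g2 z2 w1 -> ineq g3 z3 w2 ->
    0 <= 3 + 2 * (g1 + g2 + g3) ->
  let x := (z1 + z2 + z3) / 3 in
  let y := - (w1 + w2 + w3) / 3 in
  0 <= (2 * x - y) * (2 * y - x) -> x ^+ 2 - x * y + y ^+ 2 <= 3 / 4.
Proof.
move=> ineq I1 I2 I3 G x y mk; set Q := x ^+ 2 - x * y + y ^+ 2.
have D1 := I1 (2 * x - y) (- (2 * y - x)) (- (2 * Q)).
have D2 := I2 (2 * x - y) (- (2 * y - x)) (- (2 * Q)).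
have D3 := I3 (2 * x - y) (- (2 * y - x)) (- (2 * Q)).
have := addr_ge0 (addr_ge0 D1 D2) D3.
have -> : z3 = 3 * x - z1 - z2 by rewrite /x; field.
have -> : w3 = - 3 * y - w1 - w2 by rewrite /y; field.
set e := (X in 0 <= X -> _).
(* Adding this product cancels every [g] term; only [x] and [y] remain. *)
have : 0 <= (3 + 2 * (g1 + g2 + g3)) * ((2 * x - y) * (2 * y - x)).
  exact: mulr_ge0.
move=> H1 H2; have := addr_ge0 H1 H2.
have -> : (3 + 2 * (g1 + g2 + g3)) * ((2 * x - y) * (2 * y - x)) + e
  = 3 * Q * (3 - 4 * Q) by rewrite /e /Q; ring.
have [Q0|Q0 _] := ltP 0 Q; last by lra.
by rewrite pmulr_rge0 ?mulr_gt0 //; lra.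
Qed.

Lemma hexagon_gram p1 p2 p3 q1 q2 q3 :
    p1 \is unitarymx -> p2 \is unitarymx -> p3 \is unitarymx ->
    q1 \is unitarymx -> q2 \is unitarymx -> q3 \is unitarymx ->
  let x := (rdot p1 q1 + rdot p2 q2 + rdot p3 q3) / 3 in
  let y := - (rdot p1 q2 + rdot p2 q3 + rdot p3 q1) / 3 in
  0 <= (2 * x - y) * (2 * y - x) -> x ^+ 2 - x * y + y ^+ 2 <= 3 / 4.
Proof.
move=> P1 P2 P3 Q1 Q2 Q3.
apply: (@hexagon_gram_ineq (rdot p1 p3) (rdot p2 p1) (rdot p3 p2)).
- by move=> m k t; exact: rdot_comb_ge0.
- by move=> m k t; exact: rdot_comb_ge0.
- by move=> m k t; exact: rdot_comb_ge0.
(* The last hypothesis is that [p1 + p2 + p3] has nonnegative square norm. *)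
have := rdot_comb_ge0 1 1 1 P1 P2 P3; rewrite !mul1r !expr1n.
rewrite (rdotC p2 p1) (rdotC p3 p2).
by move: (rdot p1 p2) (rdot p2 p3) (rdot p1 p3) => a b c; lra.
Qed.

Lemma Re_phase_pairing_le1 (e : R[i]) u v :
    `|e| = 1 -> u \is unitarymx -> v \is unitarymx ->
  complex.Re (e * (u *m v^t*) 0 0) <= 1.
Proof.
move=> ne uu uv; have := unit_pairing_le uu uv.
move: ((u *m v^t*) 0 0) => z nz; rewrite -lecR.
apply: le_trans (_ : `|e * z| <= _).
  by apply: le_trans (normc_ge_Re _); rewrite lecR ler_norm.
by rewrite normrM ne mul1r.
Qed.

(** A phase makes the difference real and nonnegative; [Re_prod3_le] spreads it over both triples,
    and vectors rescaled by phases stay unit, so [hexagon_gram] applies to the two means. *)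
Lemma hexagon_le p1 p2 p3 q1 q2 q3 :
    p1 \is unitarymx -> p2 \is unitarymx -> p3 \is unitarymx ->
    q1 \is unitarymx -> q2 \is unitarymx -> q3 \is unitarymx ->
  `|(p1 *m q1^t*) 0 0 * (p2 *m q2^t*) 0 0 * (p3 *m q3^t*) 0 0
    - (p1 *m q2^t*) 0 0 * (p2 *m q3^t*) 0 0 * (p3 *m q1^t*) 0 0|
  <= (Num.sqrt 27 / 4)%:C.
Proof.
move=> P1 P2 P3 Q1 Q2 Q3; set E := _ - _.
have [u u1 Eu] := polar_factor E.
have u0 : u != 0 by rewrite -normr_eq0 u1 oner_eq0.
have k1 : `|u^-1| = 1 by rewrite normfV u1 invr1.
have NE : `|E| = u^-1 * E by rewrite {2}Eu mulKf.
have [e1 [e2 [e3 [n1 n2 n3 ek ez]]]] := Re_prod3_le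
  ((p1 *m q1^t*) 0 0) ((p2 *m q2^t*) 0 0) ((p3 *m q3^t*) 0 0) k1.
(* The minus sign of the second product is distributed over its three factors. *)
have [f1 [f2 [f3 [m1 m2 m3 fk fz]]]] := Re_prod3_le
  (- (p1 *m q2^t*) 0 0) (- (p2 *m q3^t*) 0 0) (- (p3 *m q1^t*) 0 0) k1.
have nz z : `|z : R[i]| = 1 -> z != 0.
  by move=> nz; rewrite -normr_eq0 nz oner_eq0.
(* Gauge transformation: rescaling the six vectors by phases turns the pairings
   [z_i] into [e_i z_i] and [w_i] into [f_i w_i]. *)
pose a2 := e2 / f1; pose a3 := e2 * e3 / (f1 * f2).
pose b2 := f1; pose b3 := f1 * f2 / e2.
have na2 : `|a2| = 1 by rewrite normf_div n2 m1 divr1.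
have na3 : `|a3| = 1 by rewrite normf_div !normrM n2 n3 m1 m2 !mulr1 divr1.
have nb3 : `|b3| = 1 by rewrite normf_div !normrM n2 m1 m2 !mulr1 divr1.
have conj1 z : `|z : R[i]| = 1 -> `|conjC z| = 1 by rewrite norm_conjC.
have U2 := scale_unitary na2 P2; have U3 := scale_unitary na3 P3.
have V1 := scale_unitary (conj1 _ n1) Q1; have V2 := scale_unitary (conj1 _ m1) Q2.
have V3 := scale_unitary (conj1 _ nb3) Q3.
have U1 := scale_unitary (normr1 _) P1.
have := hexagon_gram U1 U2 U3 V1 V2 V3; rewrite /rdot !pairingZ !mul1r.
have -> : a2 * f1 = e2 by rewrite /a2 divfK ?nz.
have -> : a3 * b3 = e3 by rewrite /a3 /b3; field; rewrite !nz.
have -> : a2 * b3 = f2 by rewrite /a2 /b3; field; rewrite !nz.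
(* This closes the hexagon: the sixth phase is right because [e1 e2 e3] and [f1 f2 f3] are the same
   number. *)
have -> : a3 * e1 = f3.
  apply: (mulfI (mulf_neq0 (nz _ m1) (nz _ m2))); rewrite fk -ek /a3.
  by field; rewrite !nz.
set x := (_ / 3); set y := (_ / 3) => xy.
have ReN z : complex.Re (- z) = - complex.Re (z : R[i]) by case: z.
have fy : (complex.Re (f1 * - (p1 *m q2^t*) 0 0)
    + complex.Re (f2 * - (p2 *m q3^t*) 0 0)
    + complex.Re (f3 * - (p3 *m q1^t*) 0 0)) / 3 = y.
  by rewrite !mulrN !ReN -!opprD.
suff ReE : complex.Re `|E| <= Num.sqrt 27 / 4.
  by rewrite lecE ReE andbT (ger0_Im (normr_ge0 E)).
rewrite NE.
have -> : u^-1 * E = u^-1 * ((p1 *m q1^t*) 0 0 * (p2 *m q2^t*) 0 0 *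
    (p3 *m q3^t*) 0 0) + u^-1 * (- (p1 *m q2^t*) 0 0 * - (p2 *m q3^t*) 0 0 *
    - (p3 *m q1^t*) 0 0) by rewrite /E; ring.
rewrite ReD; apply: le_trans (lerD ez fz) _.
have x1 : x <= 1.
  rewrite /x; apply: mean3_le1.
  - exact: Re_phase_pairing_le1 n1 P1 Q1.
  - exact: Re_phase_pairing_le1 n2 P2 Q2.
  - exact: Re_phase_pairing_le1 n3 P3 Q3.
have y1 : y <= 1.
  rewrite -fy !mulrN -!mulNr; apply: mean3_le1.
  - by apply: Re_phase_pairing_le1; rewrite ?normrN.
  - by apply: Re_phase_pairing_le1; rewrite ?normrN.
  - by apply: Re_phase_pairing_le1; rewrite ?normrN.
by rewrite fy; exact: quad_form_cubes_le.
Qed.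

End Hexagon.

(** * Commutators of rank one matrices *)

Section RankOneCommutator.
Variables (C : numClosedFieldType) (d : nat).

Lemma rank1_form (u a b c e v : 'rV[C]_d) :
  (u *m (a^t* *m b) *m (c^t* *m e) *m v^t*) 0 0
  = (u *m a^t*) 0 0 * (b *m c^t*) 0 0 * (e *m v^t*) 0 0.
Proof.
have -> : u *m (a^t* *m b) *m (c^t* *m e) *m v^t*
        = (u *m a^t*) *m (b *m c^t*) *m (e *m v^t*) by rewrite !mulmxA.
by rewrite [LHS]mxE big_ord1 [X in X * _]mxE big_ord1.
Qed.

(** With [p = (u, b, e)] and [q = (a, c, v)] this is the expression of [hexagon_le]. *)
Lemma rank1_commutator_form (u a b c e v : 'rV[C]_d) :
  (u *m ((a^t* *m b) *m (c^t* *m e) - (c^t* *m e) *m (a^t* *m b)) *m v^t*) 0 0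
  = (u *m a^t*) 0 0 * (b *m c^t*) 0 0 * (e *m v^t*) 0 0
    - (u *m c^t*) 0 0 * (b *m v^t*) 0 0 * (e *m a^t*) 0 0.
Proof.
rewrite mulmxBr mulmxBl [LHS]mxE [X in _ + X]mxE.
by rewrite 2!(mulmxA u (_ *m _) (_ *m _)) !rank1_form (mulrAC ((u *m c^t*) 0 0)).
Qed.

Lemma commutator_sum (s t : 'I_d -> C) (A B : 'I_d -> 'M[C]_d) :
  (\sum_i s i *: A i) *m (\sum_j t j *: B j)
    - (\sum_j t j *: B j) *m (\sum_i s i *: A i)
  = \sum_i \sum_j (s i * t j) *: (A i *m B j - B j *m A i).
Proof.
rewrite mulmx_suml mulmx_sumr -sumrB; apply: eq_bigr => i _.
rewrite mulmx_sumr mulmx_suml -sumrB; apply: eq_bigr => j _.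
by rewrite -!scalemxAl -!scalemxAr !scalerA scalerBr [t j * _]mulrC.
Qed.

Lemma norm_form_sum_le (u v : 'rV[C]_d) (s t : 'I_d -> C)
    (M : 'I_d -> 'I_d -> 'M[C]_d) k :
    (forall i, 0 <= s i) -> (forall j, 0 <= t j) ->
    (forall i j, `|(u *m M i j *m v^t*) 0 0| <= k) ->
  `|(u *m (\sum_i \sum_j (s i * t j) *: M i j) *m v^t*) 0 0|
  <= (\sum_i s i) * (\sum_j t j) * k.
Proof.
move=> s0 t0 Mk; rewrite mulmx_sumr mulmx_suml summxE.
apply: le_trans (ler_norm_sum _ _ _) _.
rewrite !mulr_suml; apply: ler_sum => i _; rewrite mulmx_sumr mulmx_suml summxE.
apply: le_trans (ler_norm_sum _ _ _) _.
rewrite mulr_sumr mulr_suml; apply: ler_sum => j _.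
rewrite -scalemxAr -scalemxAl mxE normrM ger0_norm ?mulr_ge0 //.
by rewrite ler_wpM2l ?mulr_ge0.
Qed.

End RankOneCommutator.

(** * The constant for the operator norm *)

Section OperatorNormOfCommutator.
Variable R : realType.
Local Open Scope complex_scope.

Lemma commutator_upper_y11 d : (0 < d)%N ->
  commutator_bounds d +oo%E 1%:E 1%:E (Num.sqrt 27 / 4 : R).
Proof.
move=> d0 X Y; rewrite -mulrA mulrC.
have [u [v [hu hv Euv]]] := schatten_normy_form (X *m Y - Y *m X) d0.
have [U [V [s [hU hV s0 sX eX]]]] := sum_rank1_unit X.
have [U' [V' [t [hU' hV' t0 tY eY]]]] := sum_rank1_unit Y.
rewrite -lecR -(ger0_norm (_ : 0 <= (schatten_norm +oo%E _)%:C)); last first.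
  by rewrite ler0c schatten_normy_ge0.
rewrite -Euv -sX -tY {1 2}eX {1 2}eY commutator_sum.
rewrite [leRHS]rmorphM [X in _ <= X * _]rmorphM !rmorph_sum /=.
apply: norm_form_sum_le => [i|j|i j]; rewrite ?ler0c //.
rewrite rank1_commutator_form.
exact: hexagon_le hu (row_unitary i hV) (row_unitary j hV')
  (row_unitary i hU) (row_unitary j hU') hv.
Qed.

(** By duality the norm is a trace [tr (W a^* b) = b W a^*], a form on unit rows. *)
Lemma schatten_norm1_rank1_le d (a b : 'rV[R[i]]_d) :
  a \is unitarymx -> b \is unitarymx -> schatten_norm 1%:E (a^t* *m b) <= 1.
Proof.
move=> ha hb; have [W hW E] := schatten_norm1_attained (a^t* *m b).
have := unitary_form_le hb hW ha; rewrite -trace_mx11 -mulmxA mxtrace_mulC.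
by rewrite -mulmxA E ger0_norm ?ler0c ?schatten_norm1_ge0 // -lecR.
Qed.

(** Real vectors in the first two coordinates let one planar example serve all [d >= 2]. *)
Definition plane_vec d (x y : R) : 'rV[R[i]]_d :=
  \row_j (if j == 0%N :> nat then x else if j == 1%N :> nat then y else 0)%:C.

Lemma plane_vec_dot d (x y x' y' : R) : (2 <= d)%N ->
  (plane_vec d x y *m (plane_vec d x' y')^t*) 0 0 = (x * x' + y * y')%:C.
Proof.
case: d => [|[|d]] // _; rewrite mxE !big_ord_recl big1 => [|j _].
  rewrite !mxE /= addr0; apply/eqP; rewrite eq_complex /=.
  by rewrite !(mulr0, mul0r, oppr0, subr0, addr0) !eqxx.
by rewrite !mxE /= mul0r.
Qed.

Lemma plane_vec_unitary d (x y : R) : (2 <= d)%N -> x ^+ 2 + y ^+ 2 = 1 ->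
  plane_vec d x y \is unitarymx.
Proof.
move=> d2 xy; apply/unitarymxP; apply/matrixP => i j; rewrite !ord1.
by rewrite plane_vec_dot // -!expr2 xy mxE.
Qed.

(* The six unit vectors of [hexagon_le] at angles 0, 30, ..., 150 degrees. *)
Lemma commutator_lower_y11 d (K : R) : (2 <= d)%N ->
  commutator_bounds d +oo%E 1%:E 1%:E K -> Num.sqrt 27 / 4 <= K.
Proof.
move=> d2; pose h : R := Num.sqrt 3 / 2.
have h2 : h ^+ 2 = 3 / 4.
  by rewrite expr_div_n sqr_sqrtr ?ler0n //; field.
(* The two triple products are [h^3] and [- h^3], the sign coming from [b] and [v], which are 150
   degrees apart. *)
have h3 : Num.sqrt 27 / 4 = 2 * h ^+ 3.
  have -> : 27 = 3 ^+ 2 * 3 :> R by ring.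
  rewrite sqrtrM ?exprn_ge0 // sqrtr_sqr ger0_norm ?ler0n //.
  by rewrite exprSr h2 /h; field.
pose a := plane_vec d 0 1; pose b := plane_vec d 1 0.
pose c := plane_vec d h 2^-1; pose e := plane_vec d (- 2^-1) h.
pose u := plane_vec d 2^-1 h; pose v := plane_vec d (- h) 2^-1.
have Hh : 2^-1 ^+ 2 + h ^+ 2 = 1 by rewrite h2; field.
have ha : a \is unitarymx by apply: plane_vec_unitary => //; ring.
have hb : b \is unitarymx by apply: plane_vec_unitary => //; ring.
have hc : c \is unitarymx by apply: plane_vec_unitary => //; rewrite addrC.
have he : e \is unitarymx by apply: plane_vec_unitary; rewrite // sqrrN.
have hu : u \is unitarymx by apply: plane_vec_unitary.
have hv : v \is unitarymx by apply: plane_vec_unitary; rewrite // sqrrN addrC.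
move=> /(_ (a^t* *m b) (c^t* *m e)); set N := schatten_norm _ (_ - _).
have XN : Num.sqrt 27 / 4 <= N.
  have := form_le_schatten_normy (a^t* *m b *m (c^t* *m e)
    - c^t* *m e *m (a^t* *m b)) hu hv.
  rewrite rank1_commutator_form.
  rewrite !plane_vec_dot // -!rmorphM -rmorphB /= => uv.
  rewrite -lecR; apply: le_trans uv; apply: le_trans (normc_ge_Re _).
  rewrite lecR /=; apply: le_trans (ler_norm _).
  by rewrite h3 le_eqVlt; apply/orP; left; apply/eqP; field.
move=> hi; apply: (bound_ge_constant _ XN hi).
- by rewrite divr_gt0 ?sqrtr_gt0 ?ltr0n.
- by rewrite schatten_norm1_ge0 schatten_norm1_rank1_le.
- by rewrite schatten_norm1_ge0 schatten_norm1_rank1_le.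
Qed.

End OperatorNormOfCommutator.

(** * Commutators of unitary matrices *)

Section UnitaryCommutator.
Variables (C : numClosedFieldType) (d : nat).
Implicit Types W U V S P : 'M[C]_d.

Lemma unitary_spectral S : S \is unitarymx -> exists P (D : 'I_d -> C),
  [/\ P \is unitarymx, S = P^t* *m diag_mx (\row_i D i) *m P &
      forall i, `|D i| = 1].
Proof.
move=> hS; have nS : S \is normalmx.
  by apply/normalmxP; rewrite (unitarymxP hS) unitarymxC.
have hP := spectral_unitarymx S; set P := spectralmx S in hP.
have ES : S = P^t* *m diag_mx (spectral_diag S) *m P.
  by have /orthomx_spectralP{1}-> := nS; rewrite invmx_unitary.
have hD : diag_mx (spectral_diag S) \is unitarymx.
  have -> : diag_mx (spectral_diag S) = P *m S *m P^t*.
    by rewrite {2}ES !mulmxA (unitarymxP hP) mul1mx mulmxtVK.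
  by rewrite !mul_unitarymx ?trmxC_unitary.
exists P, (spectral_diag S 0); split=> // [|i].
  by rewrite {1}ES; congr (_ *m diag_mx _ *m _); apply/rowP => i; rewrite mxE.
have /matrixP/(_ i i) := unitarymxP hD.
rewrite adj_diag_mx mulmx_diag !mxE eqxx !mulr1n -normCK => D2.
by apply/eqP; rewrite -(@pexpr_eq1 _ _ 2) // D2.
Qed.

(* The group commutator of [U] and [V] is unitary of determinant 1; [D] lists
   its eigenvalues. *)
Lemma unitary_commutator_trace W U V :
    W \is unitarymx -> U \is unitarymx -> V \is unitarymx ->
  exists D : 'I_d -> C, [/\ forall i, `|D i| = 1, \prod_i D i = 1 &
    `|\tr (W *m (U *m V - V *m U))| <= \sum_i `|D i - 1|].
Proof.
move=> hW hU hV; have hVU := mul_unitarymx hV hU.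
have hS : (V *m U)^t* *m (U *m V) \is unitarymx.
  by rewrite mul_unitarymx ?trmxC_unitary ?mul_unitarymx.
have detS : \det ((V *m U)^t* *m (U *m V)) = 1.
  rewrite det_mulmx (det_mulmx U) (mulrC (\det U)) -(det_mulmx V) -det_mulmx.
  by rewrite unitarymxC ?det1.
have [P [D [hP ES D1]]] := unitary_spectral hS; exists D; split=> //.
  have <- : \det (diag_mx (\row_i D i)) = \prod_i D i.
    by rewrite det_diag; apply: eq_bigr => i _; rewrite mxE.
  rewrite -detS ES !det_mulmx mulrAC -det_mulmx unitarymxC //.
  by rewrite det1 mul1r.
(* With [S] the group commutator, [UV - VU = VU (S - 1)], and [S - 1] is diagonal in the basis
   [P]. *)
have -> : W *m (U *m V - V *m U)
    = W *m (V *m U *m P^t* *m diag_mx (\row_i (D i - 1)) *m P).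
  have -> : diag_mx (\row_i (D i - 1)) = diag_mx (\row_i D i) - 1%:M.
    by apply/matrixP => i j; rewrite !mxE -mulrnBl.
  congr (W *m _); set T := V *m U in ES hVU *.
  rewrite (mulmxBr (T *m _)) mulmx1 mulmxBl -!(mulmxA T) -ES.
  by rewrite unitarymxC // mulmx1 mulmxA (unitarymxP hVU) mul1mx.
rewrite mxtrace_mulmx3C; apply: mxtrace_diag_le.
by rewrite !mul_unitarymx ?trmxC_unitary.
Qed.

Lemma mxtrace_unitary_le U : U \is unitarymx -> `|\tr U| <= d%:R.
Proof.
move=> hU; apply: le_trans (ler_norm_sum _ _ _) _.
rewrite -[X in _ <= X%:R]card_ord -sumr_const.
by apply: ler_sum => i _; exact: unitary_entry_le.
Qed.

(** Triangle inequality on two traces of unitaries; for even [d] this crude bound is sharp. *)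
Lemma mxtrace_commutator_le W U V :
    W \is unitarymx -> U \is unitarymx -> V \is unitarymx ->
  `|\tr (W *m (U *m V - V *m U))| <= 2 * d%:R.
Proof.
move=> hW hU hV; rewrite mulmxBr linearB /=.
apply: le_trans (ler_normB _ _) _; rewrite mulrDl mul1r.
by apply: lerD; apply: mxtrace_unitary_le; rewrite !mul_unitarymx.
Qed.

(* [U] is the clock matrix and [V] the cyclic shift, so [V U = z U V]. *)
Lemma weyl_pair_trace (z : C) : `|z| = 1 -> z ^+ d = 1 -> exists W U V,
  [/\ W \is unitarymx, U \is unitarymx, V \is unitarymx &
      \tr (W *m (U *m V - V *m U)) = d%:R * (1 - z)].
Proof.
move=> z1 zd; pose U := diag_mx (\row_(i < d) z ^+ i).
pose V : 'M[C]_d := perm_mx (perm (@ordS_inj d)).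
have hU : U \is unitarymx.
  by apply: diag_unitary => i; rewrite mxE normrX z1 expr1n.
have hV : V \is unitarymx by exact: perm_mx_unitary.
have hUV := mul_unitarymx hU hV.
exists ((U *m V)^t*), U, V; rewrite trmxC_unitary; split=> //.
have -> : V *m U = z *: (U *m V).
  apply/matrixP => i j; rewrite mul_mx_diag mul_diag_mx !mxE permE.
  case: eqP => [<-|_]; last by rewrite mul0r !mulr0.
  (* Where the cyclic shift wraps around, [z^d = 1] reduces the exponent modulo [d]. *)
  by rewrite mul1r mulr1 -exprS /= expr_mod.
rewrite -{2}[U *m V]scale1r -scalerBl -scalemxAr.
by rewrite unitarymxC // mxtraceZ mxtrace1 mulrC.
Qed.

End UnitaryCommutator.

(** * The constant for the trace norm *)

Section TraceNormOfCommutator.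
Variable R : realType.
Local Open Scope complex_scope.

Lemma sin_nondecreasing_pihalf (a b : R) :
  0 <= a -> a <= b -> b <= pi / 2 -> sin a <= sin b.
Proof.
move=> a0 ab b1; have pi0 := pi_gt0 R.
by rewrite leNgt ltr_sin ?in_itv /= -?leNgt //; apply/andP; split; lra.
Qed.

(** Concavity in tangent form: the mean value theorem gives the slope [- sin y] with [y] between [m]
    and [x], and sine increases on this range. *)
Lemma cos_tangent_le (m x : R) : 0 <= m <= pi / 2 -> 0 <= x <= pi / 2 ->
  cos x <= cos m - sin m * (x - m).
Proof.
move=> /andP[m0 m1] /andP[x0 x1].
have dcos (a b y : R) : y \in `]a, b[%R -> is_derive y 1 cos (- sin y).
  by move=> _; exact: is_derive_cos.
have ccos (a b : R) : {within `[a, b], continuous (cos : R -> R)}%classic.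
  by apply: continuous_subspaceT; exact: continuous_cos.
have [mx|xm] := leP m x.
  have [y] := MVT_segment mx (dcos m x) (ccos m x).
  rewrite in_itv /= => /andP[my yx] E.
  have := sin_nondecreasing_pihalf m0 my (le_trans yx x1).
  nra.
have [y] := MVT_segment (ltW xm) (dcos x m) (ccos x m).
rewrite in_itv /= => /andP[xy ym] E.
have := sin_nondecreasing_pihalf (le_trans x0 xy) ym m1.
nra.
Qed.

Lemma expiD (a b : R) : expi (a + b) = expi a * expi b.
Proof.
apply/eqP; rewrite eq_complex /= cosD sinD.
by rewrite [X in _ && (X == _)]addrC !eqxx.
Qed.

Lemma expi_sum n (f : 'I_n -> R) : expi (\sum_i f i) = \prod_i expi (f i).
Proof.
apply: big_morph; first exact: expiD.
by rewrite /expi cos0 sin0.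
Qed.

Lemma expi_mulrn (a : R) n : expi (a *+ n) = expi a ^+ n.
Proof.
elim: n => [|n IHn]; first by rewrite /expi cos0 sin0.
by rewrite mulrS expiD IHn exprS.
Qed.

Lemma norm_expi (a : R) : `|expi a| = 1.
Proof. by rewrite normc_def /= cos2Dsin2 sqrtr1. Qed.

(** The minus sign in [D = - e^(2it)] turns the distance to 1 into a cosine, which is concave for
    [|t| <= pi / 2]. *)
Lemma half_angle (D : R[i]) : `|D| = 1 -> exists t : R,
  [/\ `|t| <= pi / 2, D = - expi (t *+ 2) & `|D - 1| = (2 * cos t)%:C].
Proof.
move=> D1; have := add_Re2_Im2 D; rewrite D1 expr1n => /complexI.
case: D {D1} => a b /= ab.
have pi0 := pi_gt0 R.
have a1 : -1 <= a <= 1 by apply/andP; split; nra.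
have /andP[aN a1'] := a1.
(* [c] is to be [cos t], as [a = - cos (2t) = 1 - 2 (cos t)^2]. *)
pose c : R := Num.sqrt ((1 - a) / 2).
have c0 : 0 <= c by exact: sqrtr_ge0.
have c2 : c ^+ 2 = (1 - a) / 2 by rewrite sqr_sqrtr //; lra.
have c1 : c <= 1 by nra.
have cI : -1 <= c <= 1 by rewrite c1 andbT; lra.
have Cc : cos (acos c) = c by rewrite acosK // in_itv.
have Sc := sin_acos cI.
have sc0 : 0 <= sin (acos c) by rewrite Sc sqrtr_ge0.
have sc2 : sin (acos c) ^+ 2 = 1 - c ^+ 2 by rewrite sin2cos2 Cc.
have t0 := acos_ge0 cI; have tpi := acos_lepi cI.
have tle : acos c <= pi / 2.
  rewrite leNgt; apply/negP => tgt.
  have : cos (acos c) < cos (pi / 2).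
    by rewrite ltr_cos // in_itv /=; apply/andP; split; lra.
  by rewrite cos_pihalf Cc; lra.
have bE : `|b| = 2 * c * sin (acos c).
  apply/eqP; rewrite -(@eqrXn2 _ 2) ?mulr_ge0 // real_normK ?num_real //.
  by apply/eqP; rewrite 2!exprMn c2 sc2 c2; nra.
have cE : 2 * c = Num.sqrt ((a - 1) ^+ 2 + b ^+ 2).
  have -> : (a - 1) ^+ 2 + b ^+ 2 = (2 * c) ^+ 2 by rewrite exprMn c2; nra.
  by rewrite sqrtr_sqr ger0_norm // mulr_ge0.
have DE : `|(a +i* b) - 1| = (2 * c)%:C by rewrite normc_def /= subr0 -cE.
(* As [b = - sin (2t)], the sign of [t] is opposite to that of [b]. *)
have [b0|b0] := leP b 0.
  exists (acos c); split; rewrite ?Cc // ?ger0_norm //.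
  apply/eqP; rewrite eq_complex /= cos_mulr2n sin_mulr2n Cc c2.
  rewrite ler0_norm // in bE.
  by apply/andP; split; apply/eqP; [field | rewrite -[LHS]opprK bE; ring].
exists (- acos c); split; rewrite ?cosN ?Cc // ?normrN ?ger0_norm //.
apply/eqP; rewrite eq_complex /= cos_mulr2n sin_mulr2n cosN sinN Cc c2.
rewrite gtr0_norm // in bE.
by apply/andP; split; apply/eqP; [field | rewrite bE; ring].
Qed.

Lemma normc_1expi (t : R) :
  ComplexField.Normc.normc (1 + expi t) = Num.sqrt (2 + 2 * cos t).
Proof.
rewrite /= add0r; congr Num.sqrt.
by rewrite -[sin t ^+ 2](addKr (cos t ^+ 2)) cos2Dsin2; ring.
Qed.

Lemma normc_1expi_cos (t : R) : 0 <= t <= pi ->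
  ComplexField.Normc.normc (1 + expi t) = 2 * cos (t / 2).
Proof.
move=> /andP[t0 t1]; rewrite normc_1expi.
have -> : cos t = cos ((t / 2) *+ 2) by congr cos; rewrite -mulr_natr; field.
rewrite cos_mulr2n.
have -> : 2 + 2 * (cos (t / 2) ^+ 2 *+ 2 - 1) = (2 * cos (t / 2)) ^+ 2 by ring.
rewrite sqrtr_sqr ger0_norm // mulr_ge0 // cos_ge0_pihalf //.
by apply/andP; split; lra.
Qed.

Lemma sum_dist1_le d (D : 'I_d -> R[i]) : odd d ->
    (forall i, `|D i| = 1) -> \prod_i D i = 1 ->
  \sum_i `|D i - 1|
  <= (d%:R * ComplexField.Normc.normc (1 + expi (pi / d%:R : R)))%:C.
Proof.
move=> od D1 pD; have pi0 := pi_gt0 R.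
have d0 : 0 < d%:R :> R by rewrite ltr0n; case: d od {D D1 pD}.
have d1 : 1 <= d%:R :> R by rewrite ler1n; case: d od {D D1 pD d0}.
(* [m] is the value of [|t i|] when all are equal and add up to [pi / 2]; tangents are taken
   there. *)
pose m : R := pi / d%:R / 2.
have dm : d%:R * m = pi / 2 by rewrite /m; field; rewrite gt_eqF.
have m0 : 0 <= m by rewrite !divr_ge0 // ltW.
have mle : m <= pi / 2 by rewrite -dm; nra.
have dpi : 0 <= (pi / d%:R : R) <= pi.
  have -> : pi / d%:R = 2 * m by rewrite /m; field; rewrite gt_eqF.
  by apply/andP; split; [lra | lra].
rewrite (normc_1expi_cos dpi) -/m.
have /fin_all_exists[t Dt] := fun i => half_angle (D1 i).
have St : cos (\sum_i t i) = 0.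
  have : expi ((\sum_i t i) *+ 2) = -1.
    rewrite -sumrMnl expi_sum.
    transitivity (-1 * \prod_i D i); last by rewrite pD mulr1.
    have -> : \prod_i D i = \prod_i (-1 * expi (t i *+ 2)).
      by apply: eq_bigr => i _; have [_ -> _] := Dt i; rewrite mulN1r.
    rewrite big_split /= prodr_const card_ord -signr_odd od expr1.
    by rewrite !mulN1r opprK.
  move=> /(congr1 (@complex.Re R)) /=; rewrite cos_mulr2n => H.
  by apply/eqP; rewrite -sqrf_eq0; apply/eqP; lra.
(* Cosine is positive on []- pi / 2, pi / 2[], so its zero [sum t_i] lies outside. *)
have Sle : pi / 2 <= \sum_i `|t i|.
  apply: le_trans (ler_norm_sum _ _ _).
  rewrite leNgt ltr_norml; apply/negP => /cos_gt0_pihalf.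
  by rewrite St ltxx.
have -> : \sum_i `|D i - 1| = (\sum_i 2 * cos (t i))%:C.
  by rewrite rmorph_sum; apply: eq_bigr => i _; have [_ _ ->] := Dt i.
rewrite lecR.
apply: (@le_trans _ _ (\sum_i 2 * (cos m - sin m * (`|t i| - m)))).
  apply: ler_sum => i _; rewrite ler_pM2l // -cos_norm.
  have [ti _ _] := Dt i; apply: cos_tangent_le; first by rewrite m0.
  by rewrite normr_ge0.
have -> : \sum_i 2 * (cos m - sin m * (`|t i| - m))
        = \sum_i (2 * (cos m + sin m * m) + - (2 * sin m) * `|t i|).
  by apply: eq_bigr => i _; ring.
rewrite big_split /= sumr_const card_ord -mulr_sumr -mulr_natl.
have s0 : 0 <= sin m by apply: sin_ge0_pi; rewrite m0 /=; lra.
have := ler_wpM2l s0 Sle; move: (\sum_i `|t i|) => T; rewrite -dm.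
by rewrite mulNr; lra.
Qed.

(** Writing [X] and [Y] as scaled means of two unitaries makes their commutator [x y / 4] times a
    sum of four unitary ones. *)
Lemma commutator_upper_1yy d (K : R) : (0 < d)%N ->
    (forall W U V : 'M[R[i]]_d, W \is unitarymx -> U \is unitarymx ->
       V \is unitarymx -> `|\tr (W *m (U *m V - V *m U))| <= K%:C) ->
  commutator_bounds d 1%:E +oo%E +oo%E K.
Proof.
move=> d0 KP X Y; have [W hW EW] := schatten_norm1_attained (X *m Y - Y *m X).
have [U1 [U2 [hU1 hU2 EX]]] := mean_unitary X d0.
have [V1 [V2 [hV1 hV2 EY]]] := mean_unitary Y d0.
set x := schatten_norm _ X in EX *; set y := schatten_norm _ Y in EY *.
have x0 : 0 <= x by exact: schatten_normy_ge0.
have y0 : 0 <= y by exact: schatten_normy_ge0.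
rewrite -lecR -(ger0_norm (_ : 0 <= (schatten_norm _ _)%:C)); last first.
  by rewrite ler0c schatten_norm1_ge0.
rewrite -EW.
have -> : X *m Y - Y *m X = (x * y / 4)%:C *:
    (((U1 *m V1 - V1 *m U1) + (U1 *m V2 - V2 *m U1)) +
     ((U2 *m V1 - V1 *m U2) + (U2 *m V2 - V2 *m U2))).
  rewrite {1 2}EX {1 2}EY -!scalemxAl -!scalemxAr !scalerA -!rmorphM /=.
  have -> : y / 2 * (x / 2) = x * y / 4 by field.
  have -> : x / 2 * (y / 2) = x * y / 4 by field.
  rewrite -scalerBr !mulmxDl !mulmxDr; congr (_ *: _).
  by apply/matrixP => i j; rewrite !mxE; ring.
rewrite -scalemxAr mxtraceZ normrM ger0_norm ?ler0c ?divr_ge0 ?mulr_ge0 //.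
have -> : (K * x * y)%:C = (x * y / 4)%:C * (4 * K)%:C.
  by rewrite -rmorphM; congr (_ %:C); field.
rewrite ler_wpM2l ?ler0c ?divr_ge0 ?mulr_ge0 //.
have := KP _ _ _ hW hU2 hV2; have := KP _ _ _ hW hU2 hV1.
have := KP _ _ _ hW hU1 hV2; have := KP _ _ _ hW hU1 hV1.
move: (_ - _) (_ - _) (_ - _) (_ - _) => A1 A2 A3 A4 h1 h2 h3 h4.
rewrite !mulmxDr !mxtraceD.
have -> : (4 * K)%:C = (K%:C + K%:C) + (K%:C + K%:C).
  by rewrite -!rmorphD; congr (_ %:C); ring.
apply: le_trans (ler_normD _ _) _; apply: lerD;
  by apply: le_trans (ler_normD _ _) _; apply: lerD.
Qed.

Lemma schatten_normy_unitary_le d (U : 'M[R[i]]_d) : (0 < d)%N ->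
  U \is unitarymx -> schatten_norm +oo%E U <= 1.
Proof.
move=> d0 hU; have [u [v [hu hv E]]] := schatten_normy_form U d0.
have := unitary_form_le hu hU hv.
by rewrite E ger0_norm ?ler0c ?schatten_normy_ge0 // -lecR.
Qed.

(** Clock and shift have operator norm at most 1; [z != 1] makes the candidate bound positive, as
    [bound_ge_constant] requires. *)
Lemma commutator_lower_1yy d (z : R[i]) (K : R) : (0 < d)%N ->
    `|z| = 1 -> z ^+ d = 1 -> z != 1 ->
    commutator_bounds d 1%:E +oo%E +oo%E K ->
  d%:R * ComplexField.Normc.normc (1 - z) <= K.
Proof.
move=> d0 z1 zd zn1; have [W [U [V [hW hU hV E]]]] := weyl_pair_trace z1 zd.
move=> /(_ U V) hi; have := mxtrace_le_schatten_norm1 (U *m V - V *m U) hW.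
rewrite E normrM normr_nat.
have -> : d%:R * `|1 - z| = (d%:R * ComplexField.Normc.normc (1 - z))%:C.
  by rewrite rmorphM rmorph_nat.
rewrite lecR => lo; apply: (bound_ge_constant _ lo hi).
- apply: mulr_gt0; first by rewrite ltr0n.
  rewrite -ltcR; suff: 0 < `|1 - z| by [].
  by rewrite normr_gt0 subr_eq0 eq_sym.
- by rewrite schatten_normy_ge0 //= (schatten_normy_unitary_le d0 hU).
- by rewrite schatten_normy_ge0 //= (schatten_normy_unitary_le d0 hV).
Qed.

End TraceNormOfCommutator.

Theorem theorem5 (R : realType) (d : nat) (hd : (2 <= d)%N) :
  [/\ (odd d ->
         is_commutator_const d 1%:E +oo%E +oo%E
           (d%:R * ComplexField.Normc.normc (1 + expi (pi / d%:R : R)))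
         /\ d%:R * ComplexField.Normc.normc (1 + expi (pi / d%:R : R))
            = d%:R * Num.sqrt (2 + 2 * cos (pi / d%:R))),
      (~~ odd d ->
         is_commutator_const d 1%:E +oo%E +oo%E (2 * d%:R : R))
    & is_commutator_const d +oo%E 1%:E 1%:E (Num.sqrt 27 / 4 : R)].
Proof.
have d0 : (0 < d)%N by exact: ltnW.
have dR0 : 0 < d%:R :> R by rewrite ltr0n.
have pi0 := pi_gt0 R.
split.
- move=> od; split; last by rewrite normc_1expi.
  split.
    apply: commutator_upper_1yy => // W U V hW hU hV.
    have [D [D1 pD le]] := unitary_commutator_trace hW hU hV.
    exact: le_trans le (sum_dist1_le od D1 pD).
  move=> K hK; set t := pi / d%:R.
  (* For odd [d], [- e^(i pi / d)] is a [d]-th root of unity as far from 1 as possible. *)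
  have z1 : `|- expi t| = 1 by rewrite normrN norm_expi.
  have zd : (- expi t) ^+ d = 1.
    rewrite exprNn -signr_odd od expr1 -expi_mulrn -mulr_natr divfK ?gt_eqF //.
    apply/eqP; rewrite eq_complex /= cospi sinpi.
    by apply/andP; split; apply/eqP; ring.
  have zn1 : - expi t != 1.
    rewrite eq_complex /= negb_and oppr_eq0; apply/orP; right.
    rewrite gt_eqF // sin_gt0_pi // divr_gt0 //= ltr_pdivrMr //.
    by rewrite ltr_pMr // ltr1n.
  by have := commutator_lower_1yy d0 z1 zd zn1 hK; rewrite opprK.
- move=> ed; split.
    apply: commutator_upper_1yy => // W U V hW hU hV.
    have dC : real_complex R (2 * d%:R) = 2 * d%:R.
      by rewrite rmorphM !rmorph_nat.
    by rewrite dC; exact: mxtrace_commutator_le.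
  move=> K hK.
  (* For even [d], the antipode [-1] of 1 is itself a [d]-th root of unity. *)
  have z1 : `|-1 : complex R| = 1 by rewrite normrN1.
  have zd : (-1 : complex R) ^+ d = 1 by rewrite -signr_odd (negPf ed).
  have zn1 : -1 != 1 :> complex R by rewrite eqNr oner_eq0.
  have := commutator_lower_1yy d0 z1 zd zn1 hK.
  rewrite opprK -(natrD _ 1 1) mulrC.
  suff -> : ComplexField.Normc.normc (2 : complex R) = 2 by [].
  apply: complexI; rewrite rmorph_nat; exact: (normr_nat _ 2).
- by split=> [|K]; [exact: commutator_upper_y11 | exact: commutator_lower_y11].
Qed.
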